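(* Let $\lambda=(\lambda_1,\lambda_2,\ldots,\lambda_\ell)$ be a (nonempty) palindromic-gap partition. Then $$|\lambda|=\frac{\ell(\lambda_1+\lambda_\ell)}{2}.$$ Equivalently, the area of the rectangle of dimensions $\ell\times(\lambda_1+\lambda_\ell)$ is equal to twice the weight of $\lambda$.
   Context: A partition is a finite sequence $\lambda=(\lambda_1,\dots,\lambda_\ell)$ of positive integers written in non-decreasing order; its weight is $|\lambda|=\lambda_1+\cdots+\lambda_\ell$. It is a palindromic-gap partition if $\lambda_{i+1}-\lambda_i=\lambda_{\ell-i+1}-\lambda_{\ell-i}$ for all $1\le i\le\ell-1$ (vacuously true if $\ell=1$). *)

(* Defs.v *)
From mathcomp Require Import all_boot all_order all_algebra.

Set Implicit Arguments.
Unset Strict Implicit.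
Unset Printing Implicit Defensive.

Import Order.TTheory GRing.Theory Num.Theory.

(* Parts are listed in non-decreasing order; the empty partition is allowed. *)
Definition is_partition (lam : seq nat) : Prop :=
  sorted leq lam /\ all (ltn 0) lam.

(* 1-based: [part lam i] is lambda_i for 1 <= i <= size lam. *)
Definition part (lam : seq nat) (i : nat) : nat := nth 0 lam i.-1.

Definition weight (lam : seq nat) : nat := \sum_(p <- lam) p.

(* The gaps are differences in int, so nothing is truncated; the index
   l - i is a nat subtraction, exact since 1 <= i <= l - 1. *)
Definition palindromic_gap_partition (lam : seq nat) : Prop :=
  is_partition lam /\
  let l := size lam in
  forall i : nat, 1 <= i <= l - 1 ->
    ((part lam i.+1)%:Z - (part lam i)%:Z =
     (part lam (l - i + 1)%N)%:Z - (part lam (l - i)%N)%:Z)%R.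

(* Main.v *)
Require Import Defs.
From mathcomp Require Import all_boot all_order all_algebra.
From mathcomp Require Import zify.

(** Gauss's pairing argument. The gap condition at [i] rearranges to
    [lambda_(i+1) + lambda_(l-i) = lambda_i + lambda_(l-i+1)]: the sum of two
    parts at mirrored positions does not change when both move one step
    inwards, so it always equals the sum of the two extreme parts
    ([mirrored_parts_sum]). Adding the sequence to its reversal therefore
    gives [l] equal terms on one side and twice the weight on the other
    ([weight_double]). *)

(** The mirrored pair starts at the two ends; the gap condition carries it one
    step inwards, and past the middle with the two parts exchanged. *)
Lemma mirrored_parts_sum (lam : seq nat) (i : nat) :
  palindromic_gap_partition lam -> i < size lam ->
  nth 0 lam i + nth 0 lam (size lam - i.+1) =
  part lam 1 + part lam (size lam).
Proof.
move=> [_ gaps]; elim: i => [|i IHi] lt_i; first by rewrite subn1.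
have/gaps : 1 <= i.+1 <= size lam - 1 by lia.
rewrite /part /= addn1 /= -subnS => gap_i.
have := IHi (ltnW lt_i); rewrite /part /=; lia.
Qed.

Lemma weight_double (lam : seq nat) :
  palindromic_gap_partition lam ->
  size lam * (part lam 1 + part lam (size lam)) = 2 * weight lam.
Proof.
move=> pal.
have wE : weight lam = \sum_(i < size lam) nth 0 lam i.
  by rewrite /weight (big_nth 0) big_mkord.
rewrite mul2n -addnn {1}wE wE [X in _ = _ + X](reindex_inj rev_ord_inj) /=.
rewrite -big_split /=.
rewrite (eq_bigr (fun=> part lam 1 + part lam (size lam))).
  by rewrite sum_nat_const card_ord.
by move=> i _; apply: mirrored_parts_sum.
Qed.

Theorem corollary15 (lam : seq nat) :
  lam <> [::] ->
  palindromic_gap_partition lam ->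
  ((weight lam)%:R =
     (size lam)%:R * ((part lam 1)%:R + (part lam (size lam))%:R) / 2%:R
       :> rat)%R
  /\ size lam * (part lam 1 + part lam (size lam)) = 2 * weight lam.
Proof.
move=> _ /weight_double wE; split=> //.
by rewrite -GRing.natrD -GRing.natrM wE mulnC GRing.natrM GRing.mulfK.
Qed.
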